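(* Consider the binary tree ($d=2$). Then the good set $G_2\subset(1,\infty)\times(0,\infty)$ is bounded by the graph of the function $\delta:(1,\infty)\to(0,\infty)$ defined by $$\delta(\gamma):=\frac12\sqrt{2\,\frac{\gamma^3-\frac14}{\sqrt{(\gamma^3+\frac14)^{\frac23}-\gamma}}-\Big(\gamma^3+\frac14\Big)^{\frac23}-2\gamma}\;-\;\frac12\sqrt{\Big(\gamma^3+\frac14\Big)^{\frac23}-\gamma}\;=\;\frac{3}{16}\gamma^{-1}+O(\gamma^{-4}),$$ where the expansion is in powers of $\gamma^{-1}$, as $\gamma\to\infty$.
   Context: The binary tree is the Cayley tree of order $d=2$, i.e. the infinite tree in which every vertex has $d+1=3$ nearest neighbours. For an integer $d\ge 2$ the good set is $G_d:=\{(\gamma,\delta)\in(1,\infty)\times(0,\infty)\mid\text{there exists an }\varepsilon>0\text{ such that }\delta+\gamma\varepsilon^d\le\varepsilon\text{ and }2d\gamma\varepsilon^{d-1}+2d\delta\varepsilon^d<1\}$. For $d=2$ this is $G_2=\{(\gamma,\delta)\in(1,\infty)\times(0,\infty)\mid\text{there exists an }\varepsilon>0\text{ such that }\delta+\gamma\varepsilon^2\le\varepsilon\text{ and }4\gamma\varepsilon+4\delta\varepsilon^2<1\}$. *)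

(* Defs.v *)
From HB Require Import structures.
From mathcomp Require Import all_boot all_order all_algebra.
From mathcomp Require Import all_classical all_reals all_analysis.

Set Implicit Arguments.
Unset Strict Implicit.
Unset Printing Implicit Defensive.

Import Order.TTheory GRing.Theory Num.Theory.
Import numFieldNormedType.Exports.

Local Open Scope classical_set_scope.
Local Open Scope ring_scope.

(* The Landau notations take a bundled filter, and [pinfty_nbhs] has none in
   the library. *)
Canonical pinfty_filter_on (R : realType) :=
  FilterType (pinfty_nbhs R) _.

Section GoodSet.
Context {R : realType}.

(* (1, +oo) x (0, +oo), in which pairs are read as (gamma, delta). *)
Definition parameter_space : set (R * R) := [set p | 1 < p.1 /\ 0 < p.2].

(* The tree in which every vertex has d + 1 neighbours; meant for d >= 2. *)
Definition good_set (d : nat) : set (R * R) :=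
  [set p | parameter_space p /\
    exists eps : R, [/\ 0 < eps,
      p.2 + p.1 * eps ^+ d <= eps &
      2 * d%:R * p.1 * eps ^+ d.-1 + 2 * d%:R * p.2 * eps ^+ d < 1]].

(* Since [parameter_space] is open, this is the topological boundary of [A]
   relative to [parameter_space]. *)
Definition relative_boundary (A : set (R * R)) : set (R * R) :=
  parameter_space `&` (closure A `\` interior A).

Definition inner_radicand (g : R) : R :=
  (g ^+ 3 + 1 / 4) `^ (2 / 3) - g.

Definition outer_radicand (g : R) : R :=
  2 * ((g ^+ 3 - 1 / 4) / Num.sqrt (inner_radicand g))
  - (g ^+ 3 + 1 / 4) `^ (2 / 3) - 2 * g.

(* [Num.sqrt] is 0 on negative numbers and [_ / 0] is 0, so this is the
   intended function of [g] only where [inner_radicand g] is positive and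
   [outer_radicand g] is nonnegative. *)
Definition critical_delta (g : R) : R :=
  1 / 2 * Num.sqrt (outer_radicand g) - 1 / 2 * Num.sqrt (inner_radicand g).

End GoodSet.

(* Main.v *)
Require Import Defs.
From HB Require Import structures.
From mathcomp Require Import all_boot all_order all_algebra.
From mathcomp Require Import all_classical all_reals all_analysis.
From mathcomp Require Import ring lra.

Import Order.TTheory GRing.Theory Num.Theory.
Import numFieldNormedType.Exports.

Local Open Scope classical_set_scope.
Local Open Scope ring_scope.

(** Write [g] for gamma and [d] for delta. At the edge of the good set both
    conditions on [e] hold with equality, [d + g e^2 = e] and
    [4 g e + 4 d e^2 = 1]. Eliminating [e] leaves the quartic equation

      [16 d^4 + 24 g d^2 + (16 g^3 - 4) d - 3 g^2 = 0].

    For [g > 1] the left-hand side is strictly increasing in [d >= 0], so it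
    has at most one positive root, and its sign tells on which side of the root
    [d] lies. Everything follows from the fact that [critical_delta g] is that
    root.

    - The closed formula is Ferrari's solution of the quartic. With
      [s = (g^3 + 1/4)^(2/3)], [a = sqrt (s - g)], [P = s/2 + g/4] and
      [Q = (g^3 - 1/4) / (2 a)], the quartic divided by 16 is
      [(d^2 + P)^2 - (a d - Q)^2], because [s^3 = (g^3 + 1/4)^2] makes
      [P^2 - Q^2 = - 3 g^2 / 16] ([resolvent_square]). The formula is the larger
      root of the quadratic factor [d^2 + a d + P - Q]; it is real and positive
      because [P < Q] ([inner_lt_outer_radicand], [critical_delta_root]).
    - From a positive root [D] of the quartic, [e] is recovered rationally
      ([boundary_quartic_witness]). It serves as witness for every [d < D], and
      for [d >= D] no witness exists since the first condition would require one
      that is at least [e], and the second one that is less than [e]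
      ([witness_lt]).
    - The quartic is continuous in [(g, d)], so the two sides of the curve are
      open, while each point of the curve is a limit of points below it.
    - The quartic equation also reads
      [d - 3 / (16 g) = (4 d - 24 g d^2 - 16 d^4) / (16 g^3)], and it forces
      [d <= 1 / (4 g)]; hence the right-hand side is [O(g^-4)]. *)

(** * The boundary quartic *)

Definition boundary_quartic {R : realFieldType} (g d : R) : R :=
  16 * d ^+ 4 + 24 * g * d ^+ 2 + (16 * g ^+ 3 - 4) * d - 3 * g ^+ 2.

Lemma boundary_quartic_mono (R : realFieldType) (g : R) : 1 < g ->
  {in Num.nneg &, {mono boundary_quartic g : x y / x < y}}.
Proof.
move=> g1; apply: leW_mono_in; apply: le_mono_in => x y.
rewrite !nnegrE => x0 y0 xy; rewrite -subr_gt0.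
have -> : boundary_quartic g y - boundary_quartic g x =
    (y - x) * (16 * (y + x) * (y ^+ 2 + x ^+ 2) + 24 * g * (y + x)
               + (16 * g ^+ 3 - 4)).
  by rewrite /boundary_quartic; ring.
apply: mulr_gt0; first by rewrite subr_gt0.
have g3 : 1 < g ^+ 3 by rewrite exprn_egt1.
have : 0 <= 16 * (y + x) * (y ^+ 2 + x ^+ 2).
  by rewrite !mulr_ge0 ?addr_ge0 ?sqr_ge0.
have : 0 <= 24 * g * (y + x) by rewrite !mulr_ge0 ?addr_ge0 //; lra.
lra.
Qed.

(** The two equations are quadratic in [e]; eliminating [e ^+ 2] between them
    leaves a linear equation, whose solution is the witness. Both equations
    then amount to the vanishing of the quartic. *)
Lemma boundary_quartic_witness (R : realFieldType) (g d : R) :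
    1 < g -> 0 < d -> boundary_quartic g d = 0 ->
  exists e : R, [/\ 0 < e, d + g * e ^+ 2 = e &
    4 * g * e + 4 * d * e ^+ 2 = 1].
Proof.
move=> g1 d0 T0.
have m0 : 0 < d + g ^+ 2 by rewrite addr_gt0 ?exprn_gt0 //; lra.
have mN0 : d + g ^+ 2 != 0 by rewrite gt_eqF.
have gN0 : g != 0 by rewrite gt_eqF //; lra.
pose e := (g + 4 * d ^+ 2) / (4 * (d + g ^+ 2)).
have eN : 4 * (d + g ^+ 2) * e = g + 4 * d ^+ 2 by rewrite /e; field.
have e1 : d + g * e ^+ 2 = e.
  apply/eqP; rewrite -subr_eq0; apply/eqP.
  have -> : d + g * e ^+ 2 - e =
      g * boundary_quartic g d / (16 * (d + g ^+ 2) ^+ 2).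
    by rewrite /e /boundary_quartic; field.
  by rewrite T0 mulr0 mul0r.
exists e; split=> //.
  have : 0 < g + 4 * d ^+ 2 by rewrite addr_gt0 ?mulr_gt0 ?exprn_gt0 //; lra.
  by move=> n0; rewrite /e divr_gt0 // mulr_gt0.
apply: (mulfI gN0).
have -> : g * (4 * g * e + 4 * d * e ^+ 2) =
    4 * d * (d + g * e ^+ 2) - 4 * d ^+ 2 + 4 * g ^+ 2 * e by ring.
rewrite e1 mulr1.
have -> : 4 * d * e - 4 * d ^+ 2 + 4 * g ^+ 2 * e =
  4 * (d + g ^+ 2) * e - 4 * d ^+ 2 by ring.
by rewrite eN addrK.
Qed.

(** The boundary witness [e] for [D] works for each [d < D], since lowering [d]
    relaxes both conditions. Conversely a witness [x] for some [d >= D] is one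
    for [D]; the second condition gives [x < e], but [t |-> t - g t^2]
    increases up to [e < 1 / (4 g)], so the first condition fails at [x]. *)
Lemma witness_lt (R : realFieldType) (g D d : R) :
    1 < g -> 0 < D -> 0 < d -> boundary_quartic g D = 0 ->
  (exists e : R, [/\ 0 < e, d + g * e ^+ 2 <= e &
     4 * g * e + 4 * d * e ^+ 2 < 1]) <-> d < D.
Proof.
move=> g1 D0 d0 T0.
have [e [e0 eD1 eD2]] := boundary_quartic_witness _ _ _ g1 D0 T0.
have g0 : 0 < g by lra.
split; last first.
  move=> dD; exists e; split=> //.
    by rewrite -[leRHS]eD1 lerD2r ltW.
  by rewrite -[ltRHS]eD2 ltrD2l ltr_pM2r ?exprn_gt0 // ltr_pM2l.
case=> x [x0 x1 x2]; rewrite ltNge; apply/negP => Dd.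
have y1 : D + g * x ^+ 2 <= x by apply: le_trans x1; rewrite lerD2r.
have y2 : 4 * g * x + 4 * D * x ^+ 2 < 1.
  apply: le_lt_trans x2; rewrite lerD2l ler_pM2r ?exprn_gt0 //.
  by rewrite ler_pM2l.
have xe : x < e.
  rewrite ltNge; apply/negP => ex.
  have : 1 <= 4 * g * x + 4 * D * x ^+ 2.
    rewrite -[leLHS]eD2 lerD ?ler_wpM2l // ?mulr_ge0 // ?(ltW g0) ?(ltW D0) //.
    by rewrite lerXn2r // nnegrE ltW.
  lra.
have ge : 4 * g * e < 1 by rewrite -[ltRHS]eD2 ltrDl !mulr_gt0 ?exprn_gt0.
have gx : g * x < g * e by rewrite ltr_pM2l.
have : 0 < (e - x) * (1 - g * e - g * x) by apply: mulr_gt0; lra.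
have -> : (e - x) * (1 - g * e - g * x) =
  e - (D + g * e ^+ 2) - (x - (D + g * x ^+ 2)) by ring.
rewrite eD1; lra.
Qed.

Lemma boundary_quartic_continuous (R : realType) :
  continuous (fun q : R * R => boundary_quartic q.1 q.2).
Proof.
move=> p.
have c1 : q.1 @[q --> p] --> p.1 by exact: cvg_fst.
have c2 : q.2 @[q --> p] --> p.2 by exact: cvg_snd.
have cX (f : R * R -> R) (l : R) n :
    f q @[q --> p] --> l -> f q ^+ n @[q --> p] --> l ^+ n.
  move=> fl; apply: (@cvg_comp _ _ _ f (fun x => x ^+ n) _ _ _ fl).
  exact: exprn_continuous.
rewrite /boundary_quartic.
by repeat first [ exact: cvg_cst | exact: c1 | exact: c2 | apply: cX
                | apply: cvgB | apply: cvgD | apply: cvgM ].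
Qed.

(** * The closed formula solves the quartic *)

Section CriticalDelta.
Context {R : realType}.
Implicit Types g d : R.

(** Trades the real power for a polynomial identity; [inner_radicand g + g] is
    the quantity [s] above. *)
Lemma radicand_cube g : 0 <= g ->
  (inner_radicand g + g) ^+ 3 = (g ^+ 3 + 1 / 4) ^+ 2.
Proof.
move=> g0; rewrite /inner_radicand subrK.
have u0 : 0 <= g ^+ 3 + 1 / 4 by rewrite addr_ge0 ?exprn_ge0.
move: (g ^+ 3 + 1 / 4) u0 => u u0.
rewrite -[LHS]powR_mulrn ?powR_ge0 // -powRrM -[RHS]powR_mulrn //.
by congr (_ `^ _); field.
Qed.

(** Cubing reduces the claim to [g^3 < (g^3 + 1/4)^2]. *)
Lemma inner_radicand_gt0 g : 1 < g -> 0 < inner_radicand g.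
Proof.
move=> g1; have g0 : 0 <= g by lra.
have g3 : 1 < g ^+ 3 by rewrite exprn_egt1.
have s0 : 0 <= inner_radicand g + g by rewrite /inner_radicand subrK powR_ge0.
rewrite -(ltrD2r g) add0r -(@ltr_pXn2r _ 3) // radicand_cube //; nra.
Qed.

(** The resolvent cubic of the quartic, solved by [s]: since
    [(g^3 - 1/4)^2 = s^3 - g^3] is divisible by [a^2 = s - g], the square of [Q]
    is [(s^2 + s g + g^2) / 4]. *)
Lemma resolvent_square g
    (Q := (g ^+ 3 - 1 / 4) / (2 * Num.sqrt (inner_radicand g)))
    (P := (inner_radicand g + g) / 2 + g / 4) :
  1 < g -> Q ^+ 2 - P ^+ 2 = 3 / 16 * g ^+ 2.
Proof.
move=> g1; have r0 := inner_radicand_gt0 g g1.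
have rN0 : inner_radicand g != 0 by rewrite gt_eqF.
have cube : (inner_radicand g + g) ^+ 3 = (g ^+ 3 + 1 / 4) ^+ 2.
  by apply: radicand_cube; lra.
rewrite {}/Q {}/P; move: (inner_radicand g) => r in r0 rN0 cube *.
rewrite expr_div_n exprMn sqr_sqrtr ?(ltW r0) //.
have -> : (g ^+ 3 - 1 / 4) ^+ 2 = r * (r ^+ 2 + 3 * r * g + 3 * g ^+ 2).
  have -> : (g ^+ 3 - 1 / 4) ^+ 2 = (g ^+ 3 + 1 / 4) ^+ 2 - g ^+ 3 by field.
  by rewrite -cube; ring.
by field.
Qed.

Lemma outer_radicandE g : outer_radicand g =
  4 * ((g ^+ 3 - 1 / 4) / (2 * Num.sqrt (inner_radicand g)))
  - (inner_radicand g + g) - 2 * g.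
Proof.
have -> : inner_radicand g + g = (g ^+ 3 + 1 / 4) `^ (2 / 3).
  by rewrite /inner_radicand subrK.
rewrite /outer_radicand invfM; move: (Num.sqrt _)^-1 => b.
by congr (_ - _ - _); field.
Qed.

(** The difference of the radicands is [4 (Q - P)], and [P < Q] because
    [Q^2 - P^2] is positive. *)
Lemma inner_lt_outer_radicand g : 1 < g -> inner_radicand g < outer_radicand g.
Proof.
move=> g1; have r0 := inner_radicand_gt0 g g1.
have g3 : 1 < g ^+ 3 by rewrite exprn_egt1 //; lra.
have := resolvent_square g g1; rewrite outer_radicandE.
set Q := _ / (2 * _); set P := _ / 2 + _ => QP.
have Q0 : 0 <= Q by rewrite divr_ge0 ?mulr_ge0 ?sqrtr_ge0 //; lra.
have P0 : 0 <= P by rewrite /P; lra.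
have : P < Q.
  rewrite -(@ltr_pXn2r _ 2) // -subr_gt0 QP mulr_gt0 ?exprn_gt0 //; lra.
rewrite /P; lra.
Qed.

Lemma critical_delta_gt0 g : 1 < g -> 0 < critical_delta g.
Proof.
move=> g1; rewrite /critical_delta -mulrBr mulr_gt0 // subr_gt0.
have io := inner_lt_outer_radicand g g1.
by rewrite ltr_sqrt // (lt_trans (inner_radicand_gt0 g g1)).
Qed.

(** Squaring [2 d + a = sqrt (outer_radicand g)] shows that
    [d] annihilates the factor [d^2 + P + (a d - Q)] of the quartic. *)
Lemma critical_delta_root g :
  1 < g -> boundary_quartic g (critical_delta g) = 0.
Proof.
move=> g1; have r0 := inner_radicand_gt0 g g1.
have o0 : 0 <= outer_radicand g.
  exact: ltW (lt_trans r0 (inner_lt_outer_radicand g g1)).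
set d := critical_delta g.
have aN0 : Num.sqrt (inner_radicand g) != 0 by rewrite gt_eqF // sqrtr_gt0.
have := resolvent_square g g1.
have : (2 * d + Num.sqrt (inner_radicand g)) ^+ 2 = outer_radicand g.
  by rewrite -[RHS]sqr_sqrtr // /d /critical_delta; congr (_ ^+ 2); field.
rewrite outer_radicandE.
have : Num.sqrt (inner_radicand g) ^+ 2 = inner_radicand g.
  by rewrite sqr_sqrtr ?ltW.
set a := Num.sqrt _ in aN0 *.
have : 2 * a * ((g ^+ 3 - 1 / 4) / (2 * a)) = g ^+ 3 - 1 / 4 by field.
set Q := _ / (2 * a).
move: (inner_radicand g) => r aQ a2 quad QP.
have f0 : d ^+ 2 + (r + g) / 2 + g / 4 + a * d - Q = 0 by lra.
have : (d ^+ 2 + ((r + g) / 2 + g / 4) + (a * d - Q)) *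
       (d ^+ 2 + ((r + g) / 2 + g / 4) - (a * d - Q)) = 0.
  by rewrite !addrA f0 mul0r.
rewrite mulrC -subr_sqr => fac.
have -> : boundary_quartic g d =
    16 * (d ^+ 4 + (r + 3 / 2 * g - a ^+ 2) * d ^+ 2 + 2 * a * Q * d
          - (Q ^+ 2 - ((r + g) / 2 + g / 4) ^+ 2)).
  by rewrite /boundary_quartic aQ a2 QP; field.
by rewrite -[RHS](mulr0 16) -[X in _ = _ * X]fac; congr (_ * _); field.
Qed.

(** * The good set and its boundary *)

Lemma good_set2E : good_set 2 =
  [set p : R * R | [/\ 1 < p.1, 0 < p.2 & p.2 < critical_delta p.1]].
Proof.
have wit g d (g1 : 1 < g) (d0 : 0 < d) :=
  witness_lt _ g _ d g1 (critical_delta_gt0 g g1) d0 (critical_delta_root g g1).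
apply/seteqP; split=> -[g d]; rewrite /good_set /parameter_space /=.
  move=> [[g1 d0] [e [e0 e1 e2]]]; split=> //.
  by apply/(wit g d g1 d0); exists e; split=> //; lra.
move=> [g1 d0 /(wit g d g1 d0)] [e [e0 e1 e2]]; split=> //.
by exists e; split=> //; rewrite expr1; lra.
Qed.

Lemma boundary_quartic_lt0 g d : 1 < g -> 0 < d ->
  (boundary_quartic g d < 0) = (d < critical_delta g).
Proof.
move=> g1 d0; have D0 := critical_delta_gt0 g g1.
rewrite -[X in _ < X](critical_delta_root g g1).
by rewrite boundary_quartic_mono // nnegrE ltW.
Qed.

Lemma boundary_quartic_gt0 g d : 1 < g -> 0 < d ->
  (0 < boundary_quartic g d) = (critical_delta g < d).
Proof.
move=> g1 d0; have D0 := critical_delta_gt0 g g1.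
rewrite -[X in X < _](critical_delta_root g g1).
by rewrite boundary_quartic_mono // nnegrE ltW.
Qed.

(** A point above the curve has a neighbourhood where the quartic is positive,
    which misses the good set; a point below has one where it is negative,
    inside the good set. A point of the curve is approached vertically from
    below. *)
Lemma relative_boundary_good_set2 : relative_boundary (good_set 2) =
  [set p : R * R | 1 < p.1 /\ p.2 = critical_delta p.1].
Proof.
rewrite good_set2E; apply/seteqP; split=> -[g d];
  rewrite /relative_boundary /parameter_space /=.
  move=> [[g1 d0] [cl ni]]; split=> //; apply/eqP; rewrite eq_le.
  apply/andP; split; rewrite leNgt; apply/negP.
    rewrite -boundary_quartic_gt0 // => T0.
    have [] := cl [set q | 0 < boundary_quartic q.1 q.2].
      exact: (cvgr_gt _ (boundary_quartic_continuous R (g, d))).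
    move=> [x y] /= [[x1 y0 yD]]; rewrite boundary_quartic_gt0 //.
    by move=> /(lt_trans yD); rewrite ltxx.
  rewrite -boundary_quartic_lt0 // => T0; apply: ni.
  have near1 : \forall q \near (g, d), 1 < q.1.
    exact: (cvgr_gt _ (@cvg_fst _ _ (nbhs g) (nbhs d) _)).
  have near2 : \forall q \near (g, d), 0 < q.2.
    exact: (cvgr_gt _ (@cvg_snd _ _ (nbhs g) (nbhs d) _)).
  have near3 := cvgr_lt _ (boundary_quartic_continuous R (g, d)) _ T0.
  rewrite /interior /=; near=> q.
  have q1 : 1 < q.1 by near: q.
  have q2 : 0 < q.2 by near: q.
  split=> //; rewrite -boundary_quartic_lt0 //.
  by near: q; exact: near3.
move=> [g1 ->] {d}; have D0 := critical_delta_gt0 g g1.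
split=> //; split; last by move=> /interior_subset [_ _ /=]; rewrite ltxx.
move=> B nB.
have gD : (g, x) @[x --> (critical_delta g)^'-] --> (g, critical_delta g).
  by apply: (@cvg_pair _ _ _ _ (nbhs g) (nbhs (critical_delta g)));
    [exact: cvg_cst | apply: cvg_at_left_filter; exact: cvg_id].
have nearB : \forall x \near (critical_delta g)^'-, B (g, x) by exact: gD.
have near0 : \forall x \near (critical_delta g)^'-, 0 < x.
  exact: nbhs_left_gt.
have nearD : \forall x \near (critical_delta g)^'-, x < critical_delta g.
  exact: nbhs_left_lt.
have [x [Bx [x0 xD]]] := filter_ex (filterI nearB (filterI near0 nearD)).
by exists (g, x).
Unshelve. all: by end_near.
Qed.

(** * Asymptotics *)

(** Solving the quartic equation for its dominant term [16 g^3 d - 3 g^2]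
    gives the error exactly, once [4 g d <= 1] bounds the other terms. *)
Lemma critical_delta_asymptotics g : 1 < g ->
  `|critical_delta g - 3 / 16 * g^-1| <= g^-1 ^+ 4.
Proof.
move=> g1; have D0 := critical_delta_gt0 g g1.
have := critical_delta_root g g1; rewrite /boundary_quartic.
move: (critical_delta g) D0 => d d0 T0.
have g0 : 0 < g by lra.
have gN0 : g != 0 by rewrite gt_eqF.
have g3 : 1 < g ^+ 3 by rewrite exprn_egt1.
(* As [12 g^3 <= 16 g^3 - 4], the equation gives [12 g^3 d <= 3 g^2]. *)
have gd : 4 * (g * d) <= 1.
  have : 0 <= 16 * d ^+ 4 + 24 * g * d ^+ 2.
    by rewrite addr_ge0 // !mulr_ge0 ?exprn_ge0 // ltW.
  have : 0 < (g ^+ 3 - 1) * d by rewrite mulr_gt0 // subr_gt0.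
  move=> h1 h2; rewrite -(@ler_pM2l _ (3 * g ^+ 2)) ?mulr_gt0 ?exprn_gt0 //.
  lra.
have i0 : 0 < g^-1 by rewrite invr_gt0.
have i1 : g^-1 < 1 by rewrite invf_lt1.
have -> : d - 3 / 16 * g^-1 =
    g^-1 ^+ 3 * ((4 * d - 24 * (g * d) * d - 16 * d ^+ 4) / 16).
  have -> : 4 * d - 24 * (g * d) * d - 16 * d ^+ 4 =
            16 * g ^+ 3 * d - 3 * g ^+ 2 by lra.
  by field.
rewrite normrM (ger0_norm (exprn_ge0 3 (ltW i0))) [leRHS]exprSr.
rewrite ler_wpM2l ?exprn_ge0 ?(ltW i0) //.
have di : 4 * d <= g^-1.
  have := ler_wpM2r (ltW i0) gd; rewrite mul1r.
  by have -> : 4 * (g * d) / g = 4 * d by field.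
have gdd0 : 0 <= (g * d) * d by rewrite !mulr_ge0 ?ltW.
have gdd : 4 * (g * d) * d <= d.
  by rewrite -[leRHS]mul1r ler_wpM2r // ltW.
have d1 : d ^+ 3 <= 1 by rewrite exprn_ile1 ?ltW //; lra.
have d4 : d ^+ 4 <= d by rewrite exprSr -[leRHS]mul1r ler_wpM2r // ltW.
have d40 : 0 <= d ^+ 4 by rewrite exprn_ge0 // ltW.
rewrite ler_norml; lra.
Qed.

End CriticalDelta.

Theorem proposition2 (R : realType) :
  [/\ (forall g : R, 1 < g ->
         [/\ 0 < inner_radicand g, 0 <= outer_radicand g &
             0 < critical_delta g]),
      good_set 2 =
        [set p : R * R | [/\ 1 < p.1, 0 < p.2 & p.2 < critical_delta p.1]],
      relative_boundary (good_set 2) =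
        [set p : R * R | 1 < p.1 /\ p.2 = critical_delta p.1] &
      (critical_delta : R -> R^o) =
        (fun g : R => 3 / 16 * g^-1 : R^o) +O_ (pinfty_nbhs R)
        (fun g : R => g^-1 ^+ 4 : R^o)].
Proof.
split.
- move=> g g1; have r0 := inner_radicand_gt0 g g1.
  split=> //; last exact: critical_delta_gt0.
  exact: ltW (lt_trans r0 (inner_lt_outer_radicand g g1)).
- exact: good_set2E.
- exact: relative_boundary_good_set2.
apply/eqaddOP; near=> k; near=> g.
have k1 : 1 <= k by near: k; exact: nbhs_pinfty_ge.
have g1 : 1 < g by near: g; exact: nbhs_pinfty_gt.
have i0 : 0 <= g^-1 ^+ 4 by rewrite exprn_ge0 // invr_ge0; lra.
rewrite (ger0_norm i0); apply: le_trans (critical_delta_asymptotics g g1) _.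
by rewrite -[leLHS]mul1r ler_wpM2r.
Unshelve. all: by end_near.
Qed.
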